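(* Let $\eta\in S_m$, $m\ge4$, be a simple permutation. Then for $k\ge2$ and $\tau\in S_k^{\text{av}(\eta)}$, $$\lim_{n\to\infty}\frac1nE_n^{\text{av}(\eta)}N_n^{(k;\tau)}=\frac1{L(\eta)^{k-1}},$$ and $$\lim_{n\to\infty}\frac1nE_n^{\text{av}(\eta)}N_n^{(k)}=\frac{|S_k^{\text{av}(\eta)}|}{L(\eta)^{k-1}},$$ where $L(\eta)$ is the Stanley-Wilf limit of $\eta$.
   Context: $S_n$ is the set of permutations $\sigma=\sigma_1\cdots\sigma_n$ of $[n]=\{1,\dots,n\}$. A permutation $\sigma\in S_n$ contains $\eta\in S_m$ ($m\le n$) as a pattern if there are indices $1\le i_1<\cdots<i_m\le n$ such that for all $1\le j,k\le m$, $\sigma_{i_j}<\sigma_{i_k}$ if and only if $\eta_j<\eta_k$; otherwise $\sigma$ avoids $\eta$. $S_n^{\text{av}(\eta)}$ is the set of $\sigma\in S_n$ avoiding $\eta$ (and $S_n^{\text{av}(\eta)}=S_n$ if $n<m$). $P_n^{\text{av}(\eta)}$ is the uniform probability measure on $S_n^{\text{av}(\eta)}$ and $E_n^{\text{av}(\eta)}$ is the corresponding expectation. A permutation $\eta\in S_m$ is simple if for all $k\in\{2,\dots,m-1\}$ and all $a\in\mathbb{N}$ with $a+k-1\le m$, the set $\{\eta_a,\dots,\eta_{a+k-1}\}$ is not equal to a block of $k$ consecutive numbers in $[m]$. The Stanley-Wilf limit of $\eta$ is $L(\eta)=\lim_{n\to\infty}|S_n^{\text{av}(\eta)}|^{1/n}$,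 which is known to exist as a finite number (Marcus–Tardos). It is also known (Atkinson–Murphy type ratio result, cited in the paper) that for simple $\eta$, $\lim_{n\to\infty}|S_{n+1}^{\text{av}(\eta)}|/|S_n^{\text{av}(\eta)}|=L(\eta)$. For $2\le k\le n$, $\tau\in S_k^{\text{av}(\eta)}$ and $\sigma\in S_n^{\text{av}(\eta)}$, $N_n^{(k;\tau)}(\sigma)$ is the number of pairs $(l,m)$ with $1\le l,m\le n-k+1$ such that $\{l,\dots,l+k-1\}=\{\sigma_m,\dots,\sigma_{m+k-1}\}$ and $\tau_i=\sigma_{m+i-1}-(l-1)$ for $i=1,\dots,k$. $N_n^{(k)}(\sigma)=\sum_{\tau\in S_k^{\text{av}(\eta)}}N_n^{(k;\tau)}(\sigma)$. *)

(* Defs.v *)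
From mathcomp Require Import all_boot all_order all_fingroup all_algebra.
From mathcomp Require Import all_classical all_reals all_analysis.

Set Implicit Arguments.
Unset Strict Implicit.
Unset Printing Implicit Defensive.

Import Order.TTheory GRing.Theory Num.Theory.
Import numFieldNormedType.Exports.

(* A permutation of [n] is an element of 'S_n = {perm 'I_n}; positions and     *)
(* values are 0-based, i.e. the value sigma_(i+1) is (sigma i).+1.             *)

(* The condition m <= n is not imposed: it is forced by the increasing f.      *)
Definition contains (m n : nat) (eta : 'S_m) (sigma : 'S_n) : bool :=
  [exists f : {ffun 'I_m -> 'I_n},
     [forall j : 'I_m, forall k : 'I_m, (j < k) ==> (f j < f k)] &&
     [forall j : 'I_m, forall k : 'I_m,
        (sigma (f j) < sigma (f k)) == (eta j < eta k)]].

Definition avoiders (m : nat) (eta : 'S_m) (n : nat) : {set 'S_n} :=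
  [set sigma : 'S_n | ~~ contains eta sigma].

Definition block (n a k : nat) : {set 'I_n} := [set i : 'I_n | a <= i < a + k].

Definition simple_perm (m : nat) (eta : 'S_m) : Prop :=
  forall k a b : nat, 2 <= k -> k < m -> a + k <= m -> b + k <= m ->
    eta @: block m a k <> block m b k.

(* N_n^{(k;tau)}(sigma): l and p are 0-based, so they range over 0, ..., n - k; *)
(* 'I_(n.+1 - k) is empty when n < k.                                          *)
Definition clusters_of (k : nat) (tau : 'S_k) (n : nat) (sigma : 'S_n) : nat :=
  #|[set lp : 'I_(n.+1 - k) * 'I_(n.+1 - k) |
      (block n lp.1 k == sigma @: block n lp.2 k) &&
      [forall i : 'I_k, forall j : 'I_n,
         (j == lp.2 + i :> nat) ==> (sigma j == lp.1 + tau i :> nat)]]|.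

Definition clusters (m : nat) (eta : 'S_m) (k n : nat) (sigma : 'S_n) : nat :=
  \sum_(tau in avoiders eta k) clusters_of tau sigma.

Local Open Scope ring_scope.

Definition unif_av (R : realType) (m : nat) (eta : 'S_m) (n : nat)
    (sigma : 'S_n) : R :=
  if sigma \in avoiders eta n then #|avoiders eta n|%:R^-1 else 0.

Definition expect_av (R : realType) (m : nat) (eta : 'S_m) (n : nat)
    (X : 'S_n -> R) : R :=
  \sum_(sigma : 'S_n) unif_av R eta sigma * X sigma.

Definition stanley_wilf (R : realType) (m : nat) (eta : 'S_m) : R :=
  limn (fun n : nat => (#|avoiders eta n|%:R : R) `^ (n%:R^-1)).

(* Main.v *)
Require Import Defs.
From mathcomp Require Import all_boot all_order all_fingroup all_algebra.
From mathcomp Require Import all_classical all_reals all_analysis.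
From mathcomp Require Import zify ring lra.
Import Order.TTheory GRing.Theory Num.Theory.
Import numFieldNormedType.Exports.

(** Let a n be the number of permutations of size n avoiding eta, and put
    A n = a n.+1, r n = A n / A n.+1.

    Inflating one entry of a permutation by a block ordered like tau, and
    collapsing a tau-cluster to a single entry, are inverse operations.  Since
    eta is simple, an occurrence of eta in an inflated permutation either has
    at most one entry in the block, and then survives the collapse, or lies
    inside the block, and then tau contains eta.  So when tau avoids eta both
    operations preserve avoidance, and pairs (avoider of size n, tau-cluster)
    correspond to pairs (avoider of size N = n - k + 1, position).  The clusters
    of all avoiders therefore number N * a N (sum_clusters_of), the quantity to
    study is (N / n) * (a N / a n), and everything reduces to the convergence
    of r to the inverse of the Stanley-Wilf limit.

    The same correspondence yields two facts about a.
    - A i * A j <= A (i + j), since a position of a permutation carries at most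
      one cluster of a given size (avoiders_supermul).
    - Let X be the number of increasing adjacencies, that is of clusters ordered
      like the identity of size 2, in a random avoider.  Collapsing one of them
      destroys at most that one, which bounds the second moment of X; comparing
      with the square of the first moment (Cauchy-Schwarz) shows that
      r n.+1 <= r n + 1 / (n + 2) (avoiders_second_moment, ratio_slow).

    So r cannot increase quickly.  Let lam be the infimum of the A d ^ (-1/d)
    for d > 0, the inverse of the growth rate of A.
    - Choose d such that mu = A d ^ (-1/d) is less than lam + e.  If r n exceeds
      lam + e for a large n, then r > mu on the d indices up to n, which
      contradicts supermultiplicativity (ratio_limsup).
    - This already makes A n nearly as large as lam ^ (-n).  If then
      r n < lam - e, then r < lam - e / 2 on a window after n of length
      proportional to n, at the end of which A violates the upper bound
      A d <= lam ^ (-d) (ratio_liminf).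

    Hence r converges to lam.  If lam > 0, then a n ^ (1/n) tends to lam^-1 by
    Cesaro's theorem applied to the logarithms of the ratios.  If lam = 0, then
    a n ^ (1/n) has no finite limit, its lim is by convention 0, and so is
    lam^-1: in both cases stanley_wilf = lam^-1 (stanley_wilfE). *)

Set Implicit Arguments.
Unset Strict Implicit.
Unset Printing Implicit Defensive.

Local Open Scope nat_scope.

(** * Permutations as functions on natural numbers *)

(** Positions of permutations of different sizes are compared throughout, so
    permutations are read as functions on nat. *)
Definition val_at n (s : 'S_n) (j : nat) : nat :=
  if insub j is Some i then val (s i) else j.

Lemma val_atE n (s : 'S_n) (i : 'I_n) : val_at s i = s i.
Proof. by rewrite /val_at valK. Qed.

Lemma val_at_lt n (s : 'S_n) j : j < n -> val_at s j < n.
Proof. by move=> lt_j; rewrite -[j]/(val (Ordinal lt_j)) val_atE. Qed.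

Lemma val_at_inj n (s : 'S_n) i j :
  i < n -> j < n -> val_at s i = val_at s j -> i = j.
Proof.
move=> lt_i lt_j; rewrite -[i]/(val (Ordinal lt_i)) -[j]/(val (Ordinal lt_j)).
by rewrite !val_atE => /val_inj/perm_inj ->.
Qed.

Lemma val_at_surj n (s : 'S_n) v : v < n -> exists2 j, j < n & val_at s j = v.
Proof.
move=> lt_v; exists (s^-1%g (Ordinal lt_v)) => //.
by rewrite val_atE permKV.
Qed.

Lemma eq_val_at n (s t : 'S_n) :
  (forall j, j < n -> val_at s j = val_at t j) -> s = t.
Proof.
by move=> eq_st; apply/permP => i; apply: val_inj; rewrite /= -!val_atE eq_st.
Qed.

(** Inverse of val_at, meaningful when v permutes [0, n); see perm_ofE. *)
Definition perm_of n (v : nat -> nat) : 'S_n :=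
  odflt 1%g [pick s : 'S_n | [forall j : 'I_n, s j == v j :> nat]].

Lemma perm_ofE n v :
    (forall j, j < n -> v j < n) ->
    (forall i j, i < n -> j < n -> v i = v j -> i = j) ->
  forall j, j < n -> val_at (perm_of n v) j = v j.
Proof.
move=> v_lt v_inj j lt_j; rewrite /perm_of; case: pickP => [s /forallP vP|no_s].
  by rewrite -[j]/(val (Ordinal lt_j)) val_atE; apply/eqP.
pose f (i : 'I_n) : 'I_n := Ordinal (v_lt _ (ltn_ord i)).
have f_inj : injective f by move=> i i' [/v_inj eq_i]; apply/val_inj/eq_i.
by move: (no_s (perm f_inj)); case/negP; apply/forallP => i; rewrite permE.
Qed.

Lemma containsP m (eta : 'S_m) n (s : 'S_n) :
  reflect (exists f : nat -> nat,
    [/\ forall j, j < m -> f j < n,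
        forall i j, i < j -> j < m -> f i < f j
      & forall i j, i < m -> j < m ->
          (val_at s (f i) < val_at s (f j)) = (val_at eta i < val_at eta j)])
  (contains eta s).
Proof.
apply: (iffP existsP) => [[g]|[f [f_lt incr vals]]].
  move=> /andP[/forallP incr /forallP vals].
  exists (fun j => if insub j is Some i then val (g i) else 0).
  have gE j (lt_j : j < m) :
      (if insub j is Some i then val (g i) else 0) = g (Ordinal lt_j).
    by rewrite insubT.
  split=> [j lt_j|i j lt_ij lt_j|i j lt_i lt_j]; first by rewrite gE.
    rewrite !gE; first exact: ltn_trans lt_j.
    move=> lt_i.
    by have /forallP/(_ (Ordinal lt_j))/implyP/= := incr (Ordinal lt_i); apply.
  rewrite !gE !val_atE.
  have /forallP/(_ (Ordinal lt_j))/eqP-> := vals (Ordinal lt_i).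
  by rewrite -!val_atE.
exists [ffun j : 'I_m => Ordinal (f_lt j (ltn_ord j))].
apply/andP; split; apply/forallP=> i; apply/forallP=> j; rewrite !ffunE.
  by apply/implyP => lt_ij; apply: incr.
by rewrite -!val_atE /= vals.
Qed.

Lemma avoidersE m (eta : 'S_m) n (s : 'S_n) :
  (s \in avoiders eta n) = ~~ contains eta s.
Proof. by rewrite inE. Qed.

(** * Simple permutations *)

Definition convex m (B : {set 'I_m}) : Prop :=
  forall i j k : 'I_m, i \in B -> k \in B -> i <= j <= k -> j \in B.

Lemma card_block n a k : a + k <= n -> #|block n a k| = k.
Proof.
move=> le_n.
have lt_n (i : 'I_k) : a + i < n by rewrite (leq_trans _ le_n)// ltn_add2l.
pose h (i : 'I_k) : 'I_n := Ordinal (lt_n i).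
have h_inj : injective h by move=> i j [/addnI/val_inj].
suff -> : block n a k = [set h i | i in 'I_k] by rewrite card_imset// card_ord.
apply/finset.setP=> j; rewrite inE; apply/idP/imsetP => [le_j|[i _ ->]]; last first.
  by rewrite /= leq_addr ltn_add2l ltn_ord.
have lt_k : j - a < k by lia.
by exists (Ordinal lt_k) => //; apply: val_inj => /=; lia.
Qed.

(** Convex sets are the blocks of simple_perm, recognized without naming their
    endpoints. *)
Lemma convex_block m (B : {set 'I_m}) :
  convex B -> exists2 a, a + #|B| <= m & B = block m a #|B|.
Proof.
move=> cB; have [->|[x xB]] := set_0Vmem B.
  exists 0; rewrite ?cards0//; apply/finset.setP=> i; rewrite !inE cards0; lia.
case: (arg_minnP (fun i : 'I_m => i : nat) xB) => a aB min_a.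
case: (arg_maxnP (fun i : 'I_m => i : nat) xB) => b bB max_b.
have le_ab := min_a b bB.
have eqB : B = block m a (b.+1 - a).
  apply/finset.setP=> i; rewrite inE; apply/idP/idP => [iB|le_i].
    have := min_a i iB; have := max_b i iB; rewrite /=; lia.
  apply: (cB a i b) => //; lia.
have lt_b := ltn_ord b.
have cardB : #|B| = b.+1 - a by rewrite eqB card_block //; lia.
by exists a; rewrite cardB //; lia.
Qed.

(** The form in which simplicity of eta is used: it is enough to know that a
    set and its image are convex. *)
Lemma simple_convex m (eta : 'S_m) (B : {set 'I_m}) :
  simple_perm eta -> convex B -> convex (eta @: B) -> 1 < #|B| -> B = [set: 'I_m].
Proof.
move=> simple_eta /convex_block[a le_a eqB] /convex_block[b].
rewrite card_imset; last exact: perm_inj.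
move=> le_b eq_etaB gt1.
have [lt_m|le_m] := ltnP #|B| m.
  by case: (simple_eta #|B| a b) => //; rewrite -eqB.
by apply/eqP; rewrite eqEcard finset.subsetT cardsT card_ord.
Qed.

(** * Inflation of an entry by a block *)

(** collapse p k contracts the interval [p, p + k) of nat to the point p, and
    expand p k is its section whose value at p is p. *)
Definition collapse p k j :=
  if j < p then j else if j < p + k then p else j - k.-1.
Definition expand p k i := if i <= p then i else i + k.-1.

Ltac position_lia :=
  intros; unfold collapse, expand in *;
  repeat match goal with
  | |- context [if ?b then _ else _] => case: (boolP b); intros
  | H : context [if ?b then _ else _] |- _ => move: H; case: (boolP b); intros
  end; lia.

Definition cluster_at k (tau : 'S_k) n (s : 'S_n) (l p : nat) : Prop :=
  forall i, i < k -> val_at s (p + i) = l + val_at tau i.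

(** s arises from s' by replacing its entry at position p by a block ordered
    like tau. Off the block, s is determined by commuting with the collapse of
    the block of positions and of the block of values. *)
Definition inflation k (tau : 'S_k) N (s' : 'S_N) (p : nat) n (s : 'S_n) : Prop :=
  cluster_at tau s (val_at s' p) p /\
  forall j, j < n ->
    collapse (val_at s' p) k (val_at s j) = val_at s' (collapse p k j).

Definition inflate k (tau : 'S_k) N (s' : 'S_N) n (p : nat) : 'S_n :=
  perm_of n (fun j => if p <= j < p + k then val_at s' p + val_at tau (j - p)
    else expand (val_at s' p) k (val_at s' (collapse p k j))).

Definition deflate k N n (s : 'S_n) (l p : nat) : 'S_N :=
  perm_of N (fun i => collapse l k (val_at s (expand p k i))).

Section Inflation.
Variables (k N n : nat) (tau : 'S_k).
Hypotheses (k_gt0 : 0 < k) (def_n : N + k = n.+1).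

Lemma collapse_lt p j : p < N -> j < n -> collapse p k j < N.
Proof. position_lia. Qed.

Lemma expand_lt p i : p < N -> i < N -> expand p k i < n.
Proof. position_lia. Qed.

Lemma expandK p i : collapse p k (expand p k i) = i.
Proof. position_lia. Qed.

Lemma collapseK p j : ~~ (p <= j < p + k) -> expand p k (collapse p k j) = j.
Proof. position_lia. Qed.

Lemma collapse_inj p i j : collapse p k i = collapse p k j ->
  i = j \/ (p <= i < p + k) && (p <= j < p + k).
Proof. position_lia. Qed.

Lemma collapse_ltn p i j : collapse p k i <> collapse p k j ->
  (i < j) = (collapse p k i < collapse p k j).
Proof. position_lia. Qed.

Lemma inflateP (s' : 'S_N) p : p < N -> inflation tau s' p (inflate tau s' n p).
Proof.
move=> lt_p; set l := val_at s' p; have lt_l : l < N by apply: val_at_lt.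
set v := fun j => if p <= j < p + k then l + val_at tau (j - p)
  else expand l k (val_at s' (collapse p k j)).
have collapse_v j : j < n -> collapse l k (v j) = val_at s' (collapse p k j).
  move=> lt_j; rewrite /v; case: ifP => [in_j|_]; last by rewrite expandK.
  have -> : collapse p k j = p by position_lia.
  have lt_jp : j - p < k by lia.
  have := val_at_lt tau lt_jp; rewrite -/l; position_lia.
have v_lt j : j < n -> v j < n.
  move=> lt_j; have := val_at_lt s' (collapse_lt lt_p lt_j).
  rewrite -collapse_v //; position_lia.
have v_inj i j : i < n -> j < n -> v i = v j -> i = j.
  move=> lt_i lt_j eq_v; have := collapse_v i lt_i.
  rewrite eq_v collapse_v // => /val_at_inj eq_c.
  have [|//|/andP[in_i in_j]] := @collapse_inj p i j.
    by rewrite eq_c // collapse_lt.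
  move: eq_v; rewrite /v in_i in_j => /addnI/val_at_inj; lia.
have inflE := perm_ofE v_lt v_inj.
split=> [i lt_i|j lt_j]; last by rewrite inflE // collapse_v.
rewrite inflE; last by lia.
by rewrite /v leq_addr ltn_add2l lt_i addKn.
Qed.

(** A cluster fills its interval of values, so it is the whole preimage of that
    interval. *)
Lemma cluster_block (s : 'S_n) l p j : l < N -> p < N -> cluster_at tau s l p ->
  j < n -> (l <= val_at s j < l + k) = (p <= j < p + k).
Proof.
move=> lt_l lt_p cl lt_j; apply/idP/idP => [in_v|in_j].
  have [|i lt_i tau_i] := @val_at_surj k tau (val_at s j - l); first by lia.
  suff -> : j = p + i by lia.
  by apply: (@val_at_inj n s) => //; [lia|rewrite cl // tau_i; lia].
have lt_i : j - p < k by lia.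
have -> : j = p + (j - p) by lia.
rewrite cl // leq_addr ltn_add2l; exact: val_at_lt.
Qed.

Lemma deflateP (s : 'S_n) l p : l < N -> p < N -> cluster_at tau s l p ->
  val_at (deflate k N s l p) p = l /\ inflation tau (deflate k N s l p) p s.
Proof.
move=> lt_l lt_p cl; set v := fun i => collapse l k (val_at s (expand p k i)).
have in_block := cluster_block lt_l lt_p cl.
have v_lt i : i < N -> v i < N.
  by move=> lt_i; apply/collapse_lt/val_at_lt/expand_lt.
have v_inj i j : i < N -> j < N -> v i = v j -> i = j.
  move=> lt_i lt_j /collapse_inj[/val_at_inj eq_e|].
    by rewrite -(expandK p i) eq_e ?expandK // expand_lt.
  by rewrite !in_block ?expand_lt //; position_lia.
have deflE := perm_ofE v_lt v_inj.
have vp : v p = l.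
  have := in_block p; rewrite /v /expand leqnn /collapse; position_lia.
rewrite deflE // vp; split=> //; split=> [|j lt_j]; first by rewrite deflE // vp.
rewrite !deflE ?collapse_lt // vp.
have [in_j|out_j] := boolP (p <= j < p + k); last by rewrite /v collapseK.
have -> : collapse p k j = p by position_lia.
rewrite vp; have := in_block j lt_j; rewrite in_j; position_lia.
Qed.

Lemma inflation_unique (s' : 'S_N) p (s1 s2 : 'S_n) : p < N ->
  inflation tau s' p s1 -> inflation tau s' p s2 -> s1 = s2.
Proof.
move=> lt_p [cl1 co1] [cl2 co2]; apply: eq_val_at => j lt_j.
have [in_j|out_j] := boolP (p <= j < p + k).
  have -> : j = p + (j - p) by lia.
  by rewrite cl1 ?cl2 //; lia.
have lt_l := val_at_lt s' lt_p.
have := co1 j lt_j; rewrite -co2 // => /collapse_inj[//|].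
by rewrite (cluster_block lt_l lt_p cl1) // (negPf out_j).
Qed.

Lemma deflation_unique (s1 s2 : 'S_N) p (s : 'S_n) : p < N ->
    inflation tau s1 p s -> inflation tau s2 p s -> val_at s1 p = val_at s2 p ->
  s1 = s2.
Proof.
move=> lt_p [_ co1] [_ co2] eq_l; apply: eq_val_at => i lt_i.
have lt_e := expand_lt lt_p lt_i.
by rewrite -(expandK p i) -co1 // -co2 // eq_l.
Qed.

Section Avoidance.
Variables (m : nat) (eta : 'S_m) (s' : 'S_N) (p : nat) (s : 'S_n).
Hypotheses (lt_p : p < N) (infl : inflation tau s' p s).

(** The collapsed permutation occurs in the inflated one, along expand. *)
Lemma deflation_avoids : contains eta s' -> contains eta s.
Proof.
move=> /containsP[f [f_lt incr vals]]; apply/containsP.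
have [_ co] := infl.
exists (fun j => expand p k (f j)); split=> [j lt_j|i j lt_ij lt_j|i j lt_i lt_j].
- exact/expand_lt/f_lt.
- by have := incr i j lt_ij lt_j; position_lia.
rewrite -vals //.
have lt_fi := f_lt i lt_i; have lt_fj := f_lt j lt_j.
have := co _ (expand_lt lt_p lt_fi); have := co _ (expand_lt lt_p lt_fj).
rewrite !expandK => <- <-.
have [eq_f|ne_f] := eqVneq (f i) (f j); first by rewrite eq_f !ltnn.
apply: collapse_ltn; rewrite !co ?expand_lt // !expandK => /val_at_inj eq_f.
by case/eqP: ne_f; apply: eq_f.
Qed.

(** The indices j with f j in the block form a convex set with convex image
    under eta. By simplicity this set is everything, and then the occurrence
    lies in the block, or it has at most one element, and then collapsing the
    block keeps the entries of the occurrence distinct. *)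
Lemma inflation_contains : simple_perm eta ->
  contains eta s -> contains eta s' \/ contains eta tau.
Proof.
move=> simple_eta /containsP[f [f_lt incr vals]].
have [cl co] := infl; have lt_l := val_at_lt s' lt_p.
have in_block := cluster_block lt_l lt_p cl.
set l := val_at s' p in cl co in_block lt_l.
pose B := [set j : 'I_m | p <= f j < p + k].
have vals_le i j : i < m -> j < m ->
    (val_at s (f i) <= val_at s (f j)) = (val_at eta i <= val_at eta j).
  by move=> lt_i lt_j; rewrite leqNgt vals // -leqNgt.
have incr_le i j : i <= j -> j < m -> f i <= f j.
  by rewrite leq_eqVlt => /predU1P[->//|lt_ij lt_j]; apply/ltnW/incr.
have cB : convex B.
  move=> i j j'; rewrite !inE => in_i in_j' /andP[le_ij le_jj'].
  have := incr_le i j le_ij (ltn_ord _); have := incr_le j j' le_jj' (ltn_ord _).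
  lia.
have c_etaB : convex (eta @: B).
  move=> _ y _ /imsetP[i iB ->] /imsetP[j jB ->]; rewrite -[y](permKV eta).
  move: (_ y) => i' /andP[]; rewrite -!val_atE -!vals_le // => le1 le2.
  apply: imset_f; move: iB jB; rewrite !inE -!in_block ?f_lt //; lia.
have [gt1|le1] := ltnP 1 #|B|.
  right; have BT := simple_convex simple_eta cB c_etaB gt1.
  have f_in j : j < m -> p <= f j < p + k.
    by move=> lt_j; have := finset.in_setT (Ordinal lt_j); rewrite -BT inE.
  apply/containsP; exists (fun j => f j - p).
  have sE j : j < m -> val_at s (f j) = l + val_at tau (f j - p).
    by move=> lt_j; have := f_in _ lt_j => in_j; rewrite -cl ?subnKC; lia.
  split=> [j lt_j|i j lt_ij lt_j|i j lt_i lt_j].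
  - by have := f_in j lt_j; lia.
  - have := incr i j lt_ij lt_j; have := f_in i (ltn_trans lt_ij lt_j); lia.
  - by rewrite -vals // !sE // ltn_add2l.
left; have B1 i j : i < m -> j < m -> p <= f i < p + k -> p <= f j < p + k -> i = j.
  move=> lt_i lt_j in_i in_j.
  have /card_le1P/(_ (Ordinal lt_i)) := le1.
  rewrite inE => /(_ in_i (Ordinal lt_j)).
  by rewrite !inE in_j => /esym/eqP[].
apply/containsP; exists (fun j => collapse p k (f j)).
split=> [j lt_j|i j lt_ij lt_j|i j lt_i lt_j].
- exact/collapse_lt/f_lt.
- have := incr i j lt_ij lt_j; have := B1 i j (ltn_trans lt_ij lt_j) lt_j.
  position_lia.
rewrite -!co ?f_lt // -vals //.
have [<-|ne_ij] := eqVneq i j; first by rewrite !ltnn.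
apply/esym/collapse_ltn => /collapse_inj[eq_s|].
  have /(val_at_inj lt_i lt_j)/eqP : val_at eta i = val_at eta j.
    have := vals i j lt_i lt_j; have := vals j i lt_j lt_i.
    by rewrite eq_s ltnn; lia.
  by rewrite (negPf ne_ij).
rewrite !in_block ?f_lt // => /andP[in_i in_j].
by case/eqP: ne_ij; apply: B1.
Qed.

Lemma inflation_avoiders : simple_perm eta -> tau \in avoiders eta k ->
  (s \in avoiders eta n) = (s' \in avoiders eta N).
Proof.
rewrite !avoidersE => simple_eta /negPf av_tau; congr (~~ _).
apply/idP/idP => [/inflation_contains|/deflation_avoids//].
by rewrite av_tau => -[].
Qed.
End Avoidance.
End Inflation.

(** * Counting clusters *)

(** The set counted by clusters_of, with the range N of positions as a parameter
    so that no subtraction occurs in its type. *)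
Definition cluster_set k (tau : 'S_k) N n (s : 'S_n) : {set 'I_N * 'I_N} :=
  [set lp : 'I_N * 'I_N | (block n lp.1 k == s @: block n lp.2 k) &&
     [forall i : 'I_k, forall j : 'I_n,
        (j == lp.2 + i :> nat) ==> (s j == lp.1 + tau i :> nat)]].

Lemma clusters_ofE k (tau : 'S_k) N n (s : 'S_n) : N + k = n.+1 ->
  clusters_of tau s = #|cluster_set tau N s|.
Proof. by move=> def_n; rewrite /clusters_of -def_n addnK. Qed.

(** By cluster_block, a cluster maps its block of positions onto its block of
    values. *)
Lemma cluster_setP k (tau : 'S_k) N n (s : 'S_n) (x : 'I_N * 'I_N) :
    0 < k -> N + k = n.+1 ->
  reflect (cluster_at tau s x.1 x.2) (x \in cluster_set tau N s).
Proof.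
move=> k_gt0 def_n; rewrite inE; case: x => l p /=.
have [lt_l lt_p] := (ltn_ord l, ltn_ord p).
apply: (iffP andP) => [[_ /forallP cl] i lt_i|cl].
  have lt_pi : p + i < n by lia.
  have /forallP/(_ (Ordinal lt_pi))/implyP/(_ (eqxx _))/eqP := cl (Ordinal lt_i).
  by rewrite -!val_atE.
split; last first.
  apply/forallP => i; apply/forallP => j; apply/implyP => /eqP eq_j.
  by rewrite -!val_atE eq_j cl.
apply/eqP/finset.setP => v; rewrite -[v](permKV s).
rewrite finset.mem_imset; last exact: perm_inj.
by rewrite !inE -val_atE; apply: (cluster_block k_gt0 def_n lt_l lt_p cl).
Qed.

(** The bijection between avoiders of size n with a distinguished tau-cluster
    and avoiders of size N with a distinguished position, summed against an
    arbitrary weight F: F = 1 gives the first moment of the number of clusters,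
    F = clusters_of tau its second moment. *)
Lemma sum_clusters m (eta : 'S_m) k (tau : 'S_k) N n (F : 'S_n -> nat) :
    simple_perm eta -> tau \in avoiders eta k -> 0 < k -> N + k = n.+1 ->
  \sum_(s in avoiders eta n) clusters_of tau s * F s =
  \sum_(s in avoiders eta N) \sum_(p < N) F (inflate tau s n p).
Proof.
move=> simple_eta av_tau k_gt0 def_n.
under eq_bigr => s _ do rewrite (clusters_ofE _ _ def_n) -sum_nat_const.
rewrite pair_big_dep pair_big_dep.
pose h (y : 'S_N * 'I_N) : 'S_n * ('I_N * 'I_N) :=
  (inflate tau y.1 n y.2, (y.1 y.2, y.2)).
pose h' (x : 'S_n * ('I_N * 'I_N)) : 'S_N * 'I_N :=
  (deflate k N x.1 x.2.1 x.2.2, x.2.2).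
rewrite (reindex_onto h h'); last first.
  move=> [s [l p]] /andP[_ /(cluster_setP _ _ _ k_gt0 def_n)/= cl].
  have [dp infl] := deflateP k_gt0 def_n (ltn_ord l) (ltn_ord p) cl.
  have infl' := inflateP tau k_gt0 def_n (deflate k N s l p) (ltn_ord p).
  have eq_s := inflation_unique k_gt0 def_n (ltn_ord p) infl' infl.
  rewrite /h /h' /= eq_s; congr (_, (_, _)).
  by apply: val_inj; rewrite /= -val_atE.
apply: eq_bigl => -[s p]; rewrite /h /h' /=.
have infl := inflateP tau k_gt0 def_n s (ltn_ord p).
have [/= cl _] := infl.
rewrite (inflation_avoiders k_gt0 def_n (ltn_ord p) infl) //= andbT.
case: (s \in _) => //=; rewrite val_atE in cl.
have -> : (s p, p) \in cluster_set tau N (inflate tau s n p).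
  exact/(cluster_setP _ _ _ k_gt0 def_n).
have [dp infl'] := deflateP k_gt0 def_n (ltn_ord (s p)) (ltn_ord p) cl.
apply/eqP; congr (_, _).
by apply: (deflation_unique k_gt0 def_n (ltn_ord p) infl' infl); rewrite dp val_atE.
Qed.

Lemma sum_clusters_of m (eta : 'S_m) k (tau : 'S_k) N n :
    simple_perm eta -> tau \in avoiders eta k -> 0 < k -> N + k = n.+1 ->
  \sum_(s in avoiders eta n) clusters_of tau s = N * #|avoiders eta N|.
Proof.
move=> simple_eta av_tau k_gt0 def_n.
under eq_bigr => s _ do rewrite -[clusters_of _ _]muln1.
rewrite (sum_clusters (fun=> 1) simple_eta av_tau k_gt0 def_n).
under eq_bigr => s _ do rewrite sum1_card card_ord.
by rewrite sum_nat_const mulnC.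
Qed.

(** l is the least value taken on the block, and it determines tau. *)
Lemma cluster_at_unique k (tau tau' : 'S_k) n (s : 'S_n) l l' p : 0 < k ->
  cluster_at tau s l p -> cluster_at tau' s l' p -> l = l' /\ tau = tau'.
Proof.
move=> k_gt0 cl cl'.
have [i lt_i tau_i] := val_at_surj tau k_gt0.
have [i' lt_i' tau_i'] := val_at_surj tau' k_gt0.
have eq_l : l = l'.
  have := cl i lt_i; have := cl i' lt_i'; rewrite cl' // cl' //; lia.
split=> //; apply: eq_val_at => j lt_j.
by apply: (@addnI l); rewrite -cl // {1}eq_l -cl'.
Qed.

Lemma sum_clusters_leq m (eta : 'S_m) k N n (s : 'S_n) : 0 < k -> N + k = n.+1 ->
  \sum_(tau in avoiders eta k) clusters_of tau s <= N.
Proof.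
move=> k_gt0 def_n.
under eq_bigr => tau _ do rewrite (clusters_ofE tau s def_n) -sum1_card.
rewrite pair_big_dep sum1_card -[leqRHS]card_ord.
rewrite -(@card_in_imset _ _ (fun x : 'S_k * ('I_N * 'I_N) => x.2.2)) ?max_card//.
move=> [tau [l p]] [tau' [l' p']].
move=> /andP[_ /(cluster_setP _ _ _ k_gt0 def_n)/= cl].
move=> /andP[_ /(cluster_setP _ _ _ k_gt0 def_n)/= cl'] /= eq_p.
rewrite -eq_p in cl' *.
by have [/val_inj -> ->] := cluster_at_unique k_gt0 cl cl'.
Qed.

(** Summing sum_clusters_of over all tau counts all clusters of size j.+1 in
    avoiders of size (i + j).+1; each avoider has at most one for each of the
    i.+1 possible positions. *)
Lemma avoiders_supermul m (eta : 'S_m) i j : simple_perm eta ->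
  #|avoiders eta i.+1| * #|avoiders eta j.+1| <= #|avoiders eta (i + j).+1|.
Proof.
move=> simple_eta; have def_n : i.+1 + j.+1 = (i + j).+2 by rewrite addSn addnS.
rewrite -(@leq_pmul2l i.+1) // mulnA [leqRHS]mulnC -sum_nat_const.
rewrite [leqLHS]mulnC -sum_nat_const.
under eq_bigr => tau av_tau do
  rewrite -(sum_clusters_of simple_eta av_tau (ltn0Sn j) def_n).
by rewrite exchange_big; apply: leq_sum => s _; apply: sum_clusters_leq.
Qed.

Lemma contains_leq m (eta : 'S_m) n (s : 'S_n) : contains eta s -> m <= n.
Proof.
move=> /containsP[f [f_lt incr _]].
have f_inj : injective (fun j : 'I_m => Ordinal (f_lt j (ltn_ord j))).
  move=> i j [eq_f]; apply: val_inj.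
  case: (ltngtP i j) => // lt_ij.
    by have := incr i j lt_ij (ltn_ord j); rewrite eq_f ltnn.
  by have := incr j i lt_ij (ltn_ord i); rewrite eq_f ltnn.
by have := leq_card _ f_inj; rewrite !card_ord.
Qed.

Lemma short_avoiders m (eta : 'S_m) n : n < m -> avoiders eta n = [set: 'S_n].
Proof.
move=> lt_n; apply/finset.setP => s; rewrite avoidersE finset.in_setT.
by apply: contraL lt_n => /contains_leq; rewrite leqNgt.
Qed.

Lemma val_at1 n j : j < n -> val_at (1%g : 'S_n) j = j.
Proof. by move=> lt_j; rewrite -[j in LHS]/(val (Ordinal lt_j)) val_atE perm1. Qed.

Lemma cluster_succ n (s : 'S_n) l p :
  cluster_at (1%g : 'S_2) s l p <-> val_at s p = l /\ val_at s p.+1 = l.+1.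
Proof.
split=> [cl|[sp sp1] [|[|//]] _]; last 2 first.
- by rewrite addn0 val_at1 // addn0.
- by rewrite addn1 val_at1 // addn1.
have := cl 0 isT; have := cl 1 isT.
by rewrite !val_at1 // !addn0 !addn1.
Qed.

(** Collapsing an adjacency destroys no other one: if q <> p, then q and q.+1
    are not both in the collapsed block of positions, so they stay adjacent, and
    so do their values. *)
Lemma clusters_inflate n (s : 'S_n.+2) (p : 'I_n.+2) :
  clusters_of (1%g : 'S_2) (inflate (1%g : 'S_2) s n.+3 p)
    <= (clusters_of (1%g : 'S_2) s).+1.
Proof.
have def_n3 : n.+2 + 2 = n.+4 by rewrite addn2.
have def_n2 : n.+1 + 2 = n.+3 by rewrite addn2.
have infl := inflateP (1%g : 'S_2) isT def_n3 s (ltn_ord p).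
set t := inflate _ _ _ _ in infl *.
rewrite (clusters_ofE _ _ def_n3) (clusters_ofE _ _ def_n2).
set T := cluster_set _ _ t; set S := cluster_set _ _ _.
(* (s p, p) is the inflated entry itself; the other clusters inject into S. *)
rewrite (cardsD1 (s p, p) T); apply: (leq_add (leq_b1 _)).
pose h (x : 'I_n.+2 * 'I_n.+2) : 'I_n.+1 * 'I_n.+1 :=
  (inord (collapse (s p) 2 x.1), inord (collapse p 2 x.2)).
have [cl co] := infl; rewrite val_atE in cl co.
have key (x : 'I_n.+2 * 'I_n.+2) : x \in T :\ (s p, p) ->
  [/\ x.1 != s p :> nat, x.2 != p :> nat, collapse (s p) 2 x.1 < n.+1,
      collapse p 2 x.2 < n.+1
    & cluster_at (1%g : 'S_2) s (collapse (s p) 2 x.1) (collapse p 2 x.2)].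
  case: x => l q; rewrite finset.in_setD1.
  move=> /andP[ne_x /(cluster_setP _ _ _ (ltn0Sn 1) def_n3)/= cl'].
  have ne_q : q != p :> nat.
    apply: contraNneq ne_x => /val_inj eq_q; rewrite eq_q in cl' *.
    by have [/val_inj -> _] := cluster_at_unique (ltn0Sn 1) cl' cl.
  have [tq tq1] := iffLR (cluster_succ _ _ _) cl'.
  have [tp tp1] := iffLR (cluster_succ _ _ _) cl.
  have ne_l : l != s p :> nat.
    apply: contraNneq ne_q => eq_l; apply/eqP/(@val_at_inj _ t).
    - by rewrite ltnS ltnW.
    - by rewrite ltnS ltnW.
    - by rewrite tp -eq_l.
  have [lt_l lt_q] := (ltn_ord l, ltn_ord q).
  have [lt_sp lt_p] := (ltn_ord (s p), ltn_ord p).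
  split=> //; try by move: ne_l ne_q lt_l lt_q lt_sp lt_p; clear; position_lia.
  apply/cluster_succ; have := co q; have := co q.+1; rewrite tq tq1.
  have -> : collapse p 2 q.+1 = (collapse p 2 q).+1.
    by move: ne_q; clear; position_lia.
  have -> : collapse (s p) 2 l.+1 = (collapse (s p) 2 l).+1.
    by move: ne_l; clear; position_lia.
  by move=> <- //; move=> <- //; rewrite ltnS ltnW.
rewrite -(@card_in_imset _ _ h); last first.
  move=> [l q] [l' q'] /key[/= nl nq ll lq _] /key[/= nl' nq' ll' lq' _].
  move=> [/(congr1 val) eq_l /(congr1 val) eq_q]; move: eq_l eq_q.
  rewrite /= !inordK // => eq_l eq_q.
  by congr (_, _); apply: val_inj => /=; [move: nl nl' eq_l|move: nq nq' eq_q];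
    clear; position_lia.
apply/subset_leq_card/fintype.subsetP => _ /imsetP[x /key[_ _ ll lq cl'] ->].
by apply/(cluster_setP _ _ _ (ltn0Sn 1) def_n2); rewrite /= !inordK.
Qed.

Lemma cauchy_schwarz_card (T : finType) (A : {set T}) (f : T -> nat) :
  (\sum_(x in A) f x) ^ 2 <= #|A| * \sum_(x in A) f x * f x.
Proof.
rewrite -(leq_pmul2l (isT : 0 < 2)) -mulnn big_distrlr /= big_distrr /=.
under eq_bigr do rewrite big_distrr /=.
apply: (@leq_trans (\sum_(x in A) \sum_(y in A) (f x ^ 2 + f y ^ 2))).
  by do 2!(apply: leq_sum => ? _); apply: nat_Cauchy.
under eq_bigr do rewrite big_split /= sum_nat_const.
rewrite big_split /= sum_nat_const -big_distrr /= addnn -mul2n.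
by under [X in _ <= _ * (_ * X)]eq_bigr do rewrite mulnn.
Qed.

(** Cauchy-Schwarz for the number X of increasing adjacencies on the avoiders of
    size n.+3: the sum of X is n.+2 * a n.+2, and by clusters_inflate the sum of
    X ^ 2 is at most n.+2 times the sum over the avoiders of size n.+2 of their
    number of adjacencies plus one. *)
Lemma avoiders_second_moment m (eta : 'S_m) n : 2 < m -> simple_perm eta ->
  n.+2 * #|avoiders eta n.+2| ^ 2 <= #|avoiders eta n.+3| *
    (n.+1 * #|avoiders eta n.+1| + #|avoiders eta n.+2|).
Proof.
move=> gt2 simple_eta.
have av1 : (1%g : 'S_2) \in avoiders eta 2 by rewrite short_avoiders ?inE.
have def_n3 : n.+2 + 2 = n.+4 by rewrite addn2.
have def_n2 : n.+1 + 2 = n.+3 by rewrite addn2.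
have := cauchy_schwarz_card (avoiders eta n.+3)
  (clusters_of (1%g : 'S_2) (n := n.+3)).
rewrite (sum_clusters_of simple_eta av1 isT def_n3) => le1.
rewrite -(@leq_pmul2l n.+2) // mulnA mulnn -expnMn (leq_trans le1) //.
rewrite mulnCA leq_mul2l.
apply/orP; right; rewrite (sum_clusters _ simple_eta av1 isT def_n3).
rewrite -(sum_clusters_of simple_eta av1 isT def_n2) -sum1_card -big_split /=.
rewrite big_distrr; apply: leq_sum => s _.
rewrite addn1.
apply: (@leq_trans (\sum_(p < n.+2) (clusters_of (1%g : 'S_2) s).+1)).
  by apply: leq_sum => p _; apply: clusters_inflate.
by rewrite sum_nat_const card_ord.
Qed.

Local Open Scope classical_set_scope.
Local Open Scope ring_scope.

(** * Ratio limits of slowly varying supermultiplicative sequences *)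
Lemma powR_invn_expn (R : realType) (x : R) (n : nat) :
  0 <= x -> (0 < n)%N -> (x `^ n%:R^-1) ^+ n = x.
Proof.
move=> x_ge0 n_gt0; rewrite -powR_mulrn ?powR_ge0 // -powRrM mulVf ?powRr1 //.
by rewrite pnatr_eq0 -lt0n.
Qed.

Lemma expr_small (R : realType) (x e : R) : 0 <= x < 1 -> 0 < e ->
  exists D, forall d, (D <= d)%N -> x ^+ d < e.
Proof.
move=> /andP[x_ge0 x_lt1] e_gt0.
have : (fun d : nat => x ^+ d) @ \oo --> (0 : R).
  by apply: cvg_expr; rewrite ger0_norm.
move/cvgrPdist_lt => /(_ e e_gt0)[D _ small]; exists D => d le_d.
by have := small d le_d; rewrite /= sub0r normrN ger0_norm // exprn_ge0.
Qed.

Section RatioLimit.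
Variables (R : realType) (A : nat -> R).
Hypothesis A_ge1 : forall n, 1 <= A n.
Hypothesis A_supermul : forall i j, A i * A j <= A (i + j).
Hypothesis A_moment : forall n,
  n.+2%:R * A n.+1 ^+ 2 <= A n.+2 * (n.+1%:R * A n + A n.+1).

Local Notation r n := (A n / A n.+1).

Let A_gt0 n : 0 < A n. Proof. exact: lt_le_trans (A_ge1 n). Qed.

Lemma ratio_ge0 n : 0 <= r n. Proof. by rewrite divr_ge0 // ltW. Qed.

(** A_moment says (j + 2) r(j+1) <= (j + 1) r(j) + 1. *)
Lemma ratio_slow n i : r (n + i) <= r n + i%:R / n.+1%:R.
Proof.
elim: i => [|i IHi]; first by rewrite addn0 mul0r addr0.
have := A_moment (n + i); rewrite addnS.
set j := (n + i)%N in IHi *.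
have [A0 A1 A2] : [/\ 0 < A j, 0 < A j.+1 & 0 < A j.+2] by [].
have j_gt0 : 0 < j.+1%:R :> R by [].
have n_gt0 : 0 < n.+1%:R :> R by [].
have le_nj : n.+1%:R <= j.+1%:R :> R by rewrite ler_nat ltnS leq_addr.
move=> moment.
have step : r j.+1 <= r j + j.+2%:R^-1.
  have j2_gt0 : 0 < j.+2%:R :> R by [].
  rewrite -(ler_pM2l (mulr_gt0 j2_gt0 (mulr_gt0 A2 A1))).
  have -> : j.+2%:R * (A j.+2 * A j.+1) * (A j.+1 / A j.+2)
      = j.+2%:R * A j.+1 ^+ 2 by field; rewrite gt_eqF.
  have -> : j.+2%:R * (A j.+2 * A j.+1) * (A j / A j.+1 + j.+2%:R^-1)
      = A j.+2 * (j.+2%:R * A j + A j.+1) by field; rewrite (gt_eqF A1) gt_eqF.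
  apply: (le_trans moment); rewrite ler_pM2l // lerD2r ler_pM2r // ler_nat //.
apply: (le_trans step); rewrite -[i.+1%:R]natr1 mulrDl addrA mul1r lerD //.
by rewrite lef_pV2 ?posrE // (le_trans le_nj) // ler_nat.
Qed.

Lemma ratio_window_gt (mu : R) b d : 0 < mu -> (0 < d)%N ->
  (forall i, (i < d)%N -> mu < r (b + i)) -> mu ^+ d * A (b + d) < A b.
Proof.
move=> mu_gt0; elim: d => // d IHd _ win.
have last_lt : mu * A (b + d).+1 < A (b + d) by rewrite -ltr_pdivlMr ?win.
rewrite exprSr -mulrA addnS; case: d => [|d] in IHd win last_lt *.
  by rewrite expr0 mul1r; move: last_lt; rewrite addn0.
apply: lt_trans (IHd isT _) => [|i lt_i]; last by apply: win; rewrite ltnW.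
by rewrite ltr_pM2l // exprn_gt0.
Qed.

Lemma ratio_window_le (mu : R) b d : 0 <= mu ->
  (forall i, (i < d)%N -> r (b + i) <= mu) -> A b <= mu ^+ d * A (b + d).
Proof.
move=> mu_ge0; elim: d => [|d IHd] win; first by rewrite expr0 mul1r addn0.
have last_le : A (b + d) <= mu * A (b + d).+1 by rewrite -ler_pdivrMr ?win.
apply: le_trans (IHd _) _ => [i lt_i|]; first by apply: win; rewrite ltnW.
by rewrite exprSr -mulrA addnS ler_wpM2l // exprn_ge0.
Qed.

(** If r n > mu + e, then by ratio_slow r stays above mu on the d indices up to
    n, so that mu ^ d * A (b + d) < A b for the first of them, b, against
    A b * A d <= A (b + d). *)
Lemma ratio_upper (mu e : R) d :
    0 < mu -> (0 < d)%N -> 1 <= mu ^+ d * A d -> 0 < e ->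
  exists n0, forall n, (n0 <= n)%N -> r n <= mu + e.
Proof.
move=> mu_gt0 d_gt0 big_d e_gt0.
exists (Num.truncn (d%:R / e) + d)%N => n le_n.
rewrite leNgt; apply/negP => gt_n.
pose b := (n.+1 - d)%N.
have le_b : d%:R / b.+1%:R <= e.
  rewrite ler_pdivrMr // mulrC -ler_pdivrMr // ltW //.
  apply: lt_le_trans (truncnS_gt _) _; rewrite ler_nat /b.
  by move: le_n; set T := Num.truncn _; lia.
have win i : (i < d)%N -> mu < r (b + i).
  move=> lt_i; have := ratio_slow (b + i) (n - (b + i)).
  have -> : (b + i + (n - (b + i)) = n)%N by rewrite /b; lia.
  move=> slow.
  rewrite -(ltrD2r e); apply: lt_le_trans gt_n (le_trans slow _).
  rewrite lerD2l; apply: le_trans le_b.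
  rewrite ler_pM ?invr_ge0 ?ler0n // ?ler_nat; first by rewrite /b; lia.
  by rewrite lef_pV2 ?posrE // ler_nat ltnS leq_addr.
have := ratio_window_gt mu_gt0 d_gt0 win.
apply/negP; rewrite -leNgt.
apply: le_trans (_ : A b <= mu ^+ d * (A b * A d)) _.
  by rewrite mulrCA ler_peMr // ltW.
by rewrite ler_wpM2l // exprn_ge0 // ltW.
Qed.

(** The inverse of the growth rate sup (A d) ^ (1/d) of A, defined so as to
    make sense, with value 0, when the growth rate is infinite. *)
Definition inv_growth := inf [set A d.+1 `^ (- d.+1%:R^-1) | d in [set: nat]].
Local Notation lam := inv_growth.

Let roots_has_inf : has_inf [set A d.+1 `^ (- d.+1%:R^-1) | d in [set: nat]].
Proof.
split; first by exists (A 1 `^ (- 1%:R^-1)), 0%N.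
by exists 0 => _ [d _ <-]; apply: powR_ge0.
Qed.

Let rootK d : (A d.+1 `^ (- d.+1%:R^-1)) ^+ d.+1 * A d.+1 = 1.
Proof.
rewrite powRN exprVn powR_invn_expn // ?mulVf ?gt_eqF //.
exact: ltW.
Qed.

Lemma inv_growth_ge0 : 0 <= lam.
Proof.
by apply: lb_le_inf; [case: roots_has_inf | move=> _ [d _ <-]; apply: powR_ge0].
Qed.

Lemma inv_growth_bound d : lam ^+ d.+1 * A d.+1 <= 1.
Proof.
rewrite -(rootK d) ler_pM2r // lerXn2r ?nnegrE ?inv_growth_ge0 ?powR_ge0 //.
by apply: ge_inf; [case: roots_has_inf | exists d].
Qed.

Lemma ratio_limsup (e : R) :
  0 < e -> exists n0, forall n, (n0 <= n)%N -> r n <= lam + e.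
Proof.
move=> e_gt0; have e2_gt0 : 0 < e / 2 by rewrite divr_gt0.
have [_ [d _ <-] lt_mu] := inf_adherent e2_gt0 roots_has_inf.
set mu := _ `^ _ in lt_mu.
have mu_gt0 : 0 < mu by apply: powR_gt0.
have big_d : 1 <= mu ^+ d.+1 * A d.+1 by rewrite rootK.
have [n0 le_r] := ratio_upper mu_gt0 (ltn0Sn d) big_d e2_gt0.
exists n0 => n /le_r; move: lt_mu; rewrite -/lam; lra.
Qed.

(** If r n < lam - e, then by ratio_slow r <= mu = lam - e / 2 on the d indices
    from n on, where d is about n / C, so that A n <= mu ^ d * A (n + d), hence
    lam ^ n * A n <= (mu / lam) ^ d by inv_growth_bound. But by ratio_limsup
    lam ^ n * A n decreases at most like y ^ n with y < 1 as close to 1 as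
    desired; y is chosen so that y ^ C > mu / lam. *)
Lemma ratio_liminf (e : R) :
  0 < e -> exists n0, forall n, (n0 <= n)%N -> lam - e <= r n.
Proof.
move=> e_gt0; have [le_e|lt_e] := leP lam e.
  by exists 0%N => n _; apply: le_trans (ratio_ge0 n); lra.
have lam_gt0 : 0 < lam by lra.
pose mu := lam - e / 2; have mu_gt0 : 0 < mu by rewrite /mu; lra.
pose theta := mu / lam; have theta_gt0 : 0 < theta by rewrite divr_gt0.
have theta_lt1 : theta < 1 by rewrite ltr_pdivrMr // mul1r /mu; lra.
pose C := (Num.truncn (2 / e)).+1.
have C_gt : 2 / e < C%:R by apply: truncnS_gt.
pose y := ((1 + theta) / 2) `^ C%:R^-1.
have yC : y ^+ C = (1 + theta) / 2 by rewrite powR_invn_expn //; lra.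
have y_gt0 : 0 < y by apply: powR_gt0; lra.
have y_lt1 : y < 1.
  rewrite ltNge; apply/negP => /(exprn_ege1 C); rewrite yC; lra.
have [n1 le_r] : exists n1, forall n, (n1 <= n)%N -> r n <= lam / y.
  have [|n1 le_r] := @ratio_limsup (lam / y - lam).
    by rewrite subr_gt0 ltr_pdivlMr // gtr_pMr.
  by exists n1 => n /le_r; rewrite addrC subrK.
have A_lower n : (n1 <= n)%N -> lam ^+ n1 * y ^+ n <= lam ^+ n * A n.
  move=> le_n; have := @ratio_window_le (lam / y) n1 (n - n1) _ _.
  rewrite subnKC // => win; have {win} := win _ _.
  have -> : lam ^+ n = lam ^+ n1 * lam ^+ (n - n1) by rewrite -exprD subnKC.
  have -> : y ^+ n = y ^+ n1 * y ^+ (n - n1) by rewrite -exprD subnKC.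
  rewrite expr_div_n => win.
  rewrite -mulrA ler_pM2l ?exprn_gt0 //.
  have : 1 <= lam ^+ (n - n1) / y ^+ (n - n1) * A n.
    apply: le_trans (A_ge1 n1) (win _ _) => [|i _]; first by rewrite divr_ge0 ?ltW.
    by apply: le_r; rewrite leq_addr.
  rewrite mulrAC ler_pdivlMr ?exprn_gt0 // mul1r; apply: le_trans.
  by rewrite ler_piMl ?exprn_ge0 ?exprn_ile1 // ltW.
pose kappa := theta / y ^+ C.
have kappa01 : 0 <= kappa < 1.
  rewrite /kappa yC divr_ge0 ?ltW //=; last by lra.
  by rewrite ltr_pdivrMr; lra.
have [D small] := expr_small kappa01 (exprn_gt0 n1 lam_gt0).
exists (n1 + C * D)%N => n le_n; rewrite leNgt; apply/negP => lt_n.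
pose d := (n %/ C).+1.
have le_Cd : (n <= C * d)%N by rewrite /d mulnC ltnW // ltn_ceil.
have win i : (i < d)%N -> r (n + i) <= mu.
  rewrite ltnS => le_i; apply: le_trans (ratio_slow n i) _.
  have -> : mu = lam - e + e / 2 by rewrite /mu; field.
  apply: lerD; first exact: ltW.
  rewrite ler_pdivrMr //.
  have iC : i%:R * C%:R <= n.+1%:R :> R.
    rewrite -natrM ler_nat ltnW // ltnS (leq_trans _ (leq_divM n C)) //.
    by rewrite leq_mul2r le_i orbT.
  have ie : i%:R * (2 / e) <= n.+1%:R.
    by apply: le_trans iC; rewrite ler_wpM2l // ltW.
  have -> : i%:R = i%:R * (2 / e) * (e / 2) by field; rewrite gt_eqF.
  by rewrite mulrC ler_wpM2l // ltW // divr_gt0.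
have A_n := ratio_window_le (ltW mu_gt0) win.
have upper : lam ^+ n * A n <= theta ^+ d.
  apply: le_trans (_ : lam ^+ n * (mu ^+ d * A (n + d)) <= _).
    by rewrite ler_pM2l // exprn_gt0.
  have := inv_growth_bound (n + n %/ C); rewrite -addnS -/d exprD => bound.
  rewrite expr_div_n ler_pdivlMr ?exprn_gt0 //.
  have -> : lam ^+ n * (mu ^+ d * A (n + d)) * lam ^+ d
    = mu ^+ d * (lam ^+ n * lam ^+ d * A (n + d)) by ring.
  by rewrite ler_piMr // exprn_ge0 // ltW.
have lower := A_lower n (leq_trans (leq_addr _ _) le_n).
have le_D : (D <= d)%N.
  rewrite ltnW // ltnS leq_divRL // mulnC (leq_trans _ le_n) ?leq_addl //.
have := small d le_D; apply/negP; rewrite -leNgt /kappa expr_div_n.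
rewrite ler_pdivlMr ?exprn_gt0 // -exprM.
apply: le_trans (le_trans lower upper).
rewrite ler_pM2l ?exprn_gt0 //.
by rewrite ler_wiXn2l // ltW.
Qed.

Lemma ratio_cvg : (fun n => r n) @ \oo --> lam.
Proof.
apply/cvgrPdist_le => e e_gt0.
have [[n1 upper] [n2 lower]] := (ratio_limsup e_gt0, ratio_liminf e_gt0).
exists (n1 + n2)%N => // n /= le_n; rewrite ler_distlC.
by rewrite lower ?upper // (leq_trans _ le_n) ?leq_addl ?leq_addr.
Qed.

Lemma ratio_shift_cvg K : (fun n => A n / A (n + K)%N) @ \oo --> lam ^+ K.
Proof.
elim: K => [|K IHK].
  under eq_fun do rewrite addn0 divff ?gt_eqF //.
  exact: cvg_cst.
have ->: (fun n => A n / A (n + K.+1)%N) =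
    (fun n => A n / A (n + K)%N * (A (n + K)%N / A (n + K)%N.+1)).
  by apply/funext => n; rewrite addnS mulrA divfK ?gt_eqF.
rewrite exprSr; apply: cvgM => //.
by rewrite (cvg_shiftn K (fun n => r n)); apply: ratio_cvg.
Qed.

(** If the roots were bounded by M, then A n <= M ^ (n + 1) for large n, whereas
    r -> 0 makes A grow at least like (2 * M) ^ n. *)
Lemma root_diverges (a : nat -> R) : (forall n, a n.+1 = A n) -> lam = 0 ->
  ~ cvgn (fun n => a n `^ n%:R^-1).
Proof.
move=> aE lam0 /cvg_ex[/= l cv].
pose M := `|l| + 1; have M_gt0 : 0 < M by rewrite ltr_wpDl.
have [n1 _ le_M] : \forall n \near \oo, a n `^ n%:R^-1 <= M.
  move/cvgrPdist_le: cv => /(_ 1 ltr01); apply: filterS => n.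
  by have := ler_norm l; rewrite ler_distlC /M; lra.
have mu_gt0 : 0 < (2 * M)^-1 by rewrite invr_gt0 mulr_gt0.
have [n2 le_r] := ratio_limsup mu_gt0.
pose b := (n1 + n2)%N.
have half : 0 <= (2^-1 : R) < 1 by lra.
have Mb_gt0 : 0 < (M ^+ b.+1)^-1 by rewrite invr_gt0 exprn_gt0.
have [D small] := expr_small half Mb_gt0.
have win i : (i < D)%N -> r (b + i) <= (2 * M)^-1.
  move=> _; rewrite -[leRHS]add0r -lam0; apply: le_r.
  by rewrite /b -addnA addnCA leq_addr.
have lower := ratio_window_le (ltW mu_gt0) win.
have upper : A (b + D) <= M ^+ (b + D).+1.
  rewrite -(powR_invn_expn (ltW (A_gt0 (b + D))) (ltn0Sn (b + D))) -aE.
  rewrite lerXn2r ?nnegrE ?powR_ge0 ?(ltW M_gt0) //; apply: le_M.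
  by rewrite /= /b -addnA -addnS leq_addr.
have := small D (leqnn D); apply/negP; rewrite -leNgt -[leLHS]mul1r.
rewrite ler_pdivrMr ?exprn_gt0 //.
apply: le_trans (A_ge1 b) (le_trans lower _).
apply: le_trans (_ : (2 * M)^-1 ^+ D * M ^+ (b + D).+1 <= _).
  by rewrite ler_pM2l // exprn_gt0.
rewrite invfM exprMn -addSn addnC exprD mulrA -(mulrA _ _ (M ^+ D)) -exprMn.
by rewrite mulVf ?gt_eqF // expr1n mulr1.
Qed.
End RatioLimit.

Lemma root_cvg (R : realType) (a : nat -> R) (l : R) :
    (forall n, 0 < a n) -> a 0%N = 1 ->
  0 < l -> (fun n => a n.+1 / a n) @ \oo --> l ->
  (fun n => a n `^ n%:R^-1) @ \oo --> l.
Proof.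
move=> a_gt0 a0 l_gt0 cv.
have /cesaro cv_mean : (fun n => ln (a n.+1 / a n)) @ \oo --> ln l.
  by apply: continuous_cvg cv; apply: continuous_ln.
rewrite -(cvg_shiftn 1) -(lnK l_gt0).
have -> : [sequence a (n + 1)%N `^ (n + 1)%:R^-1]_n =
   (fun n => expR (arithmetic_mean (fun n => ln (a n.+1 / a n)) n)).
  apply/funext => n; rewrite /= addn1 /powR gt_eqF // /arithmetic_mean /=.
  congr (expR (_ * _)); rewrite seriesEnat /=.
  under eq_bigr do rewrite ln_div ?posrE //.
  by rewrite telescope_sumr // a0 ln1 subr0.
by apply: continuous_cvg cv_mean; apply: continuous_expR.
Qed.

(** * Asymptotics of the number of clusters *)
Section Asymptotics.
Variables (R : realType) (m : nat) (eta : 'S_m).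
Hypotheses (ge4 : (4 <= m)%N) (simple_eta : simple_perm eta).

Local Notation a n := (#|avoiders eta n|%:R : R).
Let A n : R := a n.+1.

Lemma avoiders_gt0 n : (0 < #|avoiders eta n|)%N.
Proof.
have short j : (j < m)%N -> (0 < #|avoiders eta j|)%N.
  by move=> lt_j; rewrite short_avoiders // cardsT; apply/card_gt0P; exists 1%g.
case: n => [|n]; first by apply: short; lia.
elim: n => [|n IHn]; first by apply: short; lia.
have := avoiders_supermul n 1 simple_eta; rewrite addn1; apply: leq_trans.
by rewrite muln_gt0 IHn short //; lia.
Qed.

Let A_ge1 n : 1 <= A n. Proof. by rewrite ler1n avoiders_gt0. Qed.

Let A_supermul i j : A i * A j <= A (i + j)%N.
Proof. by rewrite -natrM ler_nat avoiders_supermul. Qed.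

Let A_moment n : n.+2%:R * A n.+1 ^+ 2 <= A n.+2 * (n.+1%:R * A n + A n.+1).
Proof.
rewrite -natrX -!natrM -natrD -natrM ler_nat.
by apply: avoiders_second_moment => //; lia.
Qed.

(** If inv_growth A = 0, the roots diverge, and both lim and 0^-1 default to
    0. *)
Lemma stanley_wilfE : stanley_wilf R eta = (inv_growth A)^-1.
Proof.
rewrite /stanley_wilf.
have [lam0|lam_neq0] := eqVneq (inv_growth A) 0.
  rewrite lam0 invr0; apply: dvgP.
  exact: (root_diverges A_ge1 A_supermul A_moment).
have lam_gt0 : 0 < inv_growth A by rewrite lt_def lam_neq0 inv_growth_ge0.
apply: cvg_lim => //; apply: root_cvg => [n|||].
- by rewrite ltr0n avoiders_gt0.
- rewrite short_avoiders ?cardsT ?card_Sn //; lia.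
- by rewrite invr_gt0.
rewrite -(cvg_shiftn 1) /=.
have -> : (fun n => a (n + 1).+1 / a (n + 1)%N) = (fun n => (A n / A n.+1)^-1).
  by apply/funext => n; rewrite addn1 invf_div.
by apply: cvgV => //; apply: ratio_cvg.
Qed.

Lemma expect_avE n (X : 'S_n -> nat) :
  expect_av eta (fun s => (X s)%:R : R) =
  (\sum_(s in avoiders eta n) X s)%:R / a n.
Proof.
rewrite /expect_av natr_sum mulrC big_distrr [RHS]big_mkcond.
by apply: eq_bigr => s _; rewrite /unif_av; case: ifP; rewrite ?mul0r.
Qed.

Lemma expect_clusters_of k (tau : 'S_k) N n :
    tau \in avoiders eta k -> (0 < k)%N -> (N + k = n.+1)%N ->
  expect_av eta (fun s : 'S_n => (clusters_of tau s)%:R : R) = N%:R * a N / a n.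
Proof.
move=> av_tau k_gt0 def_n.
by rewrite expect_avE (sum_clusters_of simple_eta av_tau k_gt0 def_n) natrM.
Qed.

Lemma cluster_density k (tau : 'S_k) : tau \in avoiders eta k -> (0 < k)%N ->
  (fun n : nat => n%:R^-1 *
     expect_av eta (fun s : 'S_n => (clusters_of tau s)%:R : R))
    @ \oo --> 1 / stanley_wilf R eta ^+ (k - 1).
Proof.
case: k tau => // K tau av_tau _.
rewrite subn1 /= stanley_wilfE exprVn div1r invrK -(cvg_shiftn K.+1).
(* For permutations of size n + K + 1 there are N = n + 1 positions. *)
have -> : [sequence (n + K.+1)%:R^-1 *
     expect_av eta (fun s : 'S_(n + K.+1) => (clusters_of tau s)%:R : R)]_n
   = (fun n => (1 - K%:R * (n + K)%N.+1%:R^-1) * (A n / A (n + K)%N)).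
  apply/funext => n /=.
  rewrite (@expect_clusters_of _ _ n.+1) // addnS mulrA mulrA -(mulrA _ (a _)).
  congr (_ * _); have -> : n.+1%:R = (n + K).+1%:R - K%:R :> R.
    by rewrite -addSn natrD addrK.
  by rewrite mulrBr mulVf ?pnatr_eq0 // mulrC.
have cvK : (fun n => K%:R * (n + K)%N.+1%:R^-1) @ \oo --> (K%:R * 0 : R).
  apply: cvgM; first exact: cvg_cst.
  rewrite (cvg_shiftn K (fun n => n.+1%:R^-1 : R)); exact: cvg_harmonic.
have cvr := @ratio_shift_cvg _ _ A_ge1 A_supermul A_moment K.
rewrite mulr0 in cvK.
have -> : inv_growth A ^+ K = (1 - 0) * inv_growth A ^+ K by rewrite subr0 mul1r.
by apply: cvgM cvr; apply: cvgB cvK; apply: cvg_cst.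
Qed.

Lemma total_cluster_density k : (0 < k)%N ->
  (fun n : nat => n%:R^-1 *
     expect_av eta (fun s : 'S_n => (clusters eta k s)%:R : R))
    @ \oo --> a k / stanley_wilf R eta ^+ (k - 1).
Proof.
move=> k_gt0.
have -> : (fun n : nat => n%:R^-1 *
     expect_av eta (fun s : 'S_n => (clusters eta k s)%:R : R)) =
  (fun n => \sum_(tau in avoiders eta k)
     (n%:R^-1 * expect_av eta (fun s : 'S_n => (clusters_of tau s)%:R : R))).
  apply/funext => n; rewrite -big_distrr /=; congr (_ * _).
  under [RHS]eq_bigr do rewrite expect_avE.
  rewrite expect_avE -big_distrl -natr_sum /=; congr (_%:R * _).
  by rewrite exchange_big.
have -> : a k / stanley_wilf R eta ^+ (k - 1) =
  \sum_(tau in avoiders eta k) 1 / stanley_wilf R eta ^+ (k - 1).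
  by rewrite sumr_const mulr_natl div1r.
apply: cvg_big => [|tau av_tau]; first exact: add_continuous.
exact: cluster_density.
Qed.
End Asymptotics.

Theorem corollary4 (R : realType) (m : nat) (eta : 'S_m)
    (hm : (4 <= m)%N) (heta : simple_perm eta) (k : nat) (hk : (2 <= k)%N) :
  (forall tau : 'S_k, tau \in avoiders eta k ->
     (fun n : nat => n%:R^-1 *
        expect_av eta (fun sigma : 'S_n => (clusters_of tau sigma)%:R : R))
       @ \oo --> 1 / stanley_wilf R eta ^+ (k - 1)) /\
  (fun n : nat => n%:R^-1 *
     expect_av eta (fun sigma : 'S_n => (clusters eta k sigma)%:R : R))
    @ \oo --> #|avoiders eta k|%:R / stanley_wilf R eta ^+ (k - 1).
Proof.
split=> [tau av_tau|]; first by apply: cluster_density; rewrite ?(ltnW hk).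
by apply: total_cluster_density; rewrite ?(ltnW hk).
Qed.
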